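(* Let $\Gamma$ be a subshift of $\Lambda^\omega$ with $\Lambda$ countable. If $\Gamma$ is a subshift of bounded type and $Z\subseteq\Gamma$ is a closed internally chain transitive set (for $\sigma$), then there exists $x\in\Gamma$ with $Z=\omega(x)$. Additionally, $x$ can be chosen such that for all $\epsilon>0$ there exists $N\in\omega$ such that $d(\sigma^i(x),Z)<\epsilon$ for all $i\ge N$.
   Context: Let $\omega=\{0,1,2,\dots\}$; ''countable'' means finite or countably infinite. $\Lambda^\omega$ is the set of infinite sequences $x=x_0x_1x_2\cdots$ over $\Lambda$, with the product topology where $\Lambda$ is discrete, metrized by $d(x,y)=\inf\{2^{-n}: x_i=y_i \text{ for all } i<n\}$; the shift map is $\sigma(x_0x_1x_2\cdots)=x_1x_2\cdots$. A subshift of $\Lambda^\omega$ is a closed set $\Gamma\subseteq\Lambda^\omega$ with $\sigma(\Gamma)=\Gamma$. A word is a finite sequence over $\Lambda$ of length at least $1$; it is allowed for $\Gamma$ if it occurs as a block of consecutive symbols (subword) of some $x\in\Gamma$, and forbidden otherwise. A basis for the forbidden words of $\Gamma$ is a set $\mathcal F$ of forbidden words such that every forbidden word contains some element of $\mathcal F$ as a subword. $\Gamma$ is a subshift of bounded type (SBT) if it has a basis for its forbidden words such that, for some $n\in\mathbb N$, every element of the basis has length less than $n$. For a point $x$, $\omega(x)=\bigcap_{N\in\omega}\overline{\{\sigma^i(x):i\ge N\}}$. For $\delta>0$, a $\delta$-chain from $a$ to $b$ is a finite sequence $x_0,x_1,\dots,x_n$ with $x_0=a$, $x_n=b$ and $d(\sigma(x_i),x_{i+1})<\delta$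 for all $i<n$. A set $A$ is internally chain transitive (ICT) if for all $a,b\in A$ and all $\delta>0$ there is a $\delta$-chain from $a$ to $b$ consisting of elements of $A$. Also $d(y,Z)=\inf_{z\in Z}d(y,z)$.
   Formalization: Z is assumed nonempty, and δ-chains are required to have at least one step (n ≥ 1); otherwise Z = ∅, or a singleton {a} with σ(a) ≠ a, would be closed and internally chain transitive without being an ω-limit set. *)

(* Defs.v *)
From HB Require Import structures.
From mathcomp Require Import all_boot all_order all_algebra.
From mathcomp Require Import all_classical all_reals all_analysis.

Set Implicit Arguments.
Unset Strict Implicit.
Unset Printing Implicit Defensive.

Import Order.TTheory GRing.Theory Num.Theory.

Local Open Scope classical_set_scope.
Local Open Scope ring_scope.

Notation seqspace L := {ptws nat -> discrete_topology L}.

Definition shift_map (L : choiceType) (x : seqspace L) : seqspace L :=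
  fun i => x i.+1.

Definition sdist (R : realType) (L : choiceType) (x y : seqspace L) : R :=
  inf [set 2^-1 ^+ n | n in [set n : nat | forall i, (i < n)%N -> x i = y i]].

(* [inf] is real-valued with [inf set0 = 0], so this is the usual distance to
   a set only when [Z] is nonempty. *)
Definition sdist_set (R : realType) (L : choiceType) (y : seqspace L)
    (Z : set (seqspace L)) : R :=
  inf [set sdist R y z | z in Z].

Definition subshift (L : choiceType) (G : set (seqspace L)) : Prop :=
  closed G /\ @shift_map L @` G = G.

Definition occurs_in (L : choiceType) (w : seq L) (x : seqspace L) : Prop :=
  exists i : nat, w = mkseq (fun j => x (i + j)%N) (size w).

Definition allowed (L : choiceType) (G : set (seqspace L)) (w : seq L) : Prop :=
  (0 < size w)%N /\ exists2 x, G x & occurs_in w x.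

Definition forbidden (L : choiceType) (G : set (seqspace L)) (w : seq L) : Prop :=
  (0 < size w)%N /\ ~ allowed G w.

Definition forbidden_basis (L : choiceType) (G : set (seqspace L))
    (F : set (seq L)) : Prop :=
  F `<=` forbidden G /\
  forall w, forbidden G w -> exists2 u, F u & infix u w.

Definition bounded_type (L : choiceType) (G : set (seqspace L)) : Prop :=
  exists2 F : set (seq L), forbidden_basis G F &
    exists n : nat, forall w, F w -> (size w < n)%N.

Definition omega_limit (L : choiceType) (x : seqspace L) : set (seqspace L) :=
  \bigcap_(N in [set: nat]) closure [set iter i (@shift_map L) x | i in [set i | (N <= i)%N]].

(* Chains have at least one step: if the one-point chain from [a] to [a] were
   accepted, every singleton would be internally chain transitive. *)
Definition delta_chain_in (R : realType) (L : choiceType) (A : set (seqspace L))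
    (delta : R) (a b : seqspace L) : Prop :=
  exists (n : nat) (c : nat -> seqspace L),
    [/\ (0 < n)%N, c 0%N = a, c n = b,
        forall i, (i <= n)%N -> A (c i) &
        forall i, (i < n)%N -> sdist R (shift_map (c i)) (c i.+1) < delta].

Definition internally_chain_transitive (R : realType) (L : choiceType)
    (A : set (seqspace L)) : Prop :=
  forall a b : seqspace L, A a -> A b ->
  forall delta : R, 0 < delta -> delta_chain_in A delta a b.

Lemma sdist_lt (R : realType) (L : choiceType) (x y : seqspace L) (n : nat) :
  sdist R x y < 2^-1 ^+ n <-> forall i, (i <= n)%N -> x i = y i.
Proof.
rewrite /sdist; set A := (X in inf X).
have h0 : (0 : R) < 2^-1 by rewrite invr_gt0 ltr0n.
have h1 : (2^-1 : R) < 1 by rewrite invf_lt1 ?ltr1n ?ltr0n.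
have A0 : has_inf A.
  split; first by exists (2^-1 ^+ 0), 0%N.
  by exists 0 => _ [k _ <-]; rewrite exprn_ge0// ltW.
split=> [|xy].
  move=> /(inf_lt A0.1)[_ [k xyk <-]].
  rewrite ltr_iXn2l// => nk i ni; apply: xyk; exact: leq_ltn_trans nk.
apply: (@le_lt_trans _ _ (2^-1 ^+ n.+1)); last by rewrite ltr_iXn2l.
apply: ge_inf; first exact: A0.2.
by exists n.+1.
Qed.

(* [sdist] induces the product topology. *)
Lemma nbhs_sdist (R : realType) (L : choiceType) (x : seqspace L)
    (A : set (seqspace L)) :
  nbhs x A <->
  exists2 e : R, 0 < e & [set y | sdist R x y < e] `<=` A.
Proof.
have h0 : (0 : R) < 2^-1 by rewrite invr_gt0 ltr0n.
have h1 : (2^-1 : R) < 1 by rewrite invf_lt1 ?ltr1n ?ltr0n.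
have cyl n : nbhs x [set y : seqspace L | forall i, (i <= n)%N -> x i = y i].
  elim: n => [|n IH].
    have := @proj_continuous _ (fun _ : nat => discrete_topology L) 0%N x.
    move=> /(_ [set x 0%N]) [].
      by rewrite nbhs_principalE; apply/principal_filterP.
    move=> B [oB Bx] BS; exists B; split => // y /BS /= yx.
    by move=> i; rewrite leqn0 => /eqP ->.
  have P : nbhs x [set y : seqspace L | y n.+1 = x n.+1].
    have := @proj_continuous _ (fun _ : nat => discrete_topology L) n.+1 x.
    move=> /(_ [set x n.+1]); apply.
    by rewrite nbhs_principalE; apply/principal_filterP.
  apply: filterS (filterI IH P) => y [h e] i.
  by rewrite leq_eqVlt => /predU1P[->//|]; rewrite ltnS; apply: h.
split=> [xA|[e e0 eA]].
  pose F : set_system (seqspace L) := filter_from [set: nat]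
    (fun n => [set y | forall i, (i <= n)%N -> x i = y i]).
  have FF : Filter F.
    apply: filter_from_filter; first by exists 0%N.
    move=> m n _ _; exists (maxn m n) => // y h; split=> i im; apply: h.
      by rewrite leq_max im.
    by rewrite leq_max im orbT.
  have [n _ nA] : F A.
    suff /(_ A xA) : F --> x by [].
    apply/cvg_sup => i B [C [[D oD <-] Dx] DB].
    by exists i => // y /(_ i (leqnn i)) xy; apply: DB; rewrite /= -xy.
  exists (2^-1 ^+ n); first exact: exprn_gt0.
  by move=> y /sdist_lt h; apply: nA.
have [n ne] : exists n : nat, 2^-1 ^+ n < e.
  exists (Num.bound e^-1); have := upper_nthrootP (leqnn (Num.bound e^-1)).
  by rewrite exprVn -[X in _ -> _ < X]invrK ltf_pV2 ?posrE ?invr_gt0// exprn_gt0.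
apply: filterS (cyl n) => y /(@sdist_lt R) xy.
by apply: eA => /=; apply: lt_trans ne.
Qed.

(* Main.v *)
Require Import Defs.
From mathcomp Require Import all_boot all_order all_algebra.
From mathcomp Require Import all_classical all_reals all_analysis.

Import Order.TTheory GRing.Theory Num.Theory.
Local Open Scope classical_set_scope.
Local Open Scope ring_scope.

(** A closed internally chain transitive set [Z] is separable, so finer and
    finer chains in [Z] through a dense sequence concatenate to a pseudo-orbit
    [z_0, z_1, ...] of [Z] whose errors tend to [0] and which accumulates
    exactly on [Z].  The sequence [x] of the first symbols of the [z_k] shadows
    the pseudo-orbit: the [k]-th shift of [x] and [z_k] agree on longer and
    longer prefixes.  When all errors are small with respect to the length of
    the forbidden words of the basis, no such word occurs in [x]. *)

(** * Prefix agreement as a substitute for the metric *)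

(** The bound is inclusive to match [sdist_lt]: the relation is equivalent to
    [sdist R x y < 2^-1 ^+ n]. *)
Definition agree {L : choiceType} (n : nat) (x y : seqspace L) : Prop :=
  forall i, (i <= n)%N -> x i = y i.

Lemma agree_sym (L : choiceType) n (x y : seqspace L) :
  agree n x y -> agree n y x.
Proof. by move=> xy i /xy. Qed.

Lemma agree_trans (L : choiceType) n (x y z : seqspace L) :
  agree n x y -> agree n y z -> agree n x z.
Proof. by move=> xy yz i ni; rewrite xy// yz. Qed.

Lemma agree_le (L : choiceType) m n (x y : seqspace L) :
  (m <= n)%N -> agree n x y -> agree m x y.
Proof. by move=> mn xy i im; apply: xy; apply: leq_trans mn. Qed.

Lemma half_expr_lt (R : realType) (e : R) :
  0 < e -> exists n : nat, 2^-1 ^+ n < e.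
Proof.
move=> e0; exists (Num.bound e^-1).
have := upper_nthrootP (leqnn (Num.bound e^-1)).
by rewrite exprVn -[X in _ -> _ < X]invrK ltf_pV2 ?posrE ?invr_gt0// exprn_gt0.
Qed.

Lemma nbhs_agree (R : realType) (L : choiceType) (x : seqspace L)
    (A : set (seqspace L)) :
  nbhs x A <-> exists n, agree n x `<=` A.
Proof.
split=> [/(nbhs_sdist R)[e /half_expr_lt[n ne] eA]|[n nA]].
  exists n => y /(sdist_lt R x y n) xy; apply: eA => /=.
  exact: lt_trans ne.
apply/(nbhs_sdist R); exists (2^-1 ^+ n).
  by rewrite exprn_gt0// invr_gt0 ltr0n.
by move=> y /sdist_lt xy; apply: nA.
Qed.

Lemma closure_agree (R : realType) (L : choiceType) (x : seqspace L)
    (A : set (seqspace L)) :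
  closure A x <-> forall n, exists2 y, A y & agree n x y.
Proof.
split=> [Ax n|Ax B /(nbhs_agree R)[n nB]].
  have [|y [Ay xy]] := Ax (agree n x); last by exists y.
  by apply/(nbhs_agree R); exists n.
by have [y Ay xy] := Ax n; exists y; split=> //; apply: nB.
Qed.

Lemma iter_shift_map (L : choiceType) (x : seqspace L) i j :
  iter i (@shift_map L) x j = x (i + j)%N.
Proof. by elim: i j => [//|i IH] j; rewrite iterS /shift_map IH addnS. Qed.

Lemma omega_limit_agree (R : realType) (L : choiceType) (x y : seqspace L) :
  omega_limit x y <->
  forall n N, exists2 i, (N <= i)%N & agree n y (iter i (@shift_map L) x).
Proof.
split=> [xy n N|xy N _].
  by have /(closure_agree R)/(_ n)[_ [i Ni <-] yi] := xy N I; exists i.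
apply/(closure_agree R) => n; have [i Ni yi] := xy n N.
by exists (iter i (@shift_map L) x) => //; exists i.
Qed.

Lemma sdist_ge0 (R : realType) (L : choiceType) (x y : seqspace L) :
  0 <= sdist R x y.
Proof.
apply: lb_le_inf; first by exists (2^-1 ^+ 0), 0%N.
by move=> _ [k _ <-]; rewrite exprn_ge0// invr_ge0 ler0n.
Qed.

Lemma sdist_set_lt (R : realType) (L : choiceType) (y z : seqspace L)
    (Z : set (seqspace L)) (n : nat) :
  Z z -> agree n y z -> sdist_set R y Z < 2^-1 ^+ n.
Proof.
move=> Zz /(sdist_lt R y z n); apply: le_lt_trans; apply: ge_inf.
  by exists 0 => _ [u _ <-]; apply: sdist_ge0.
by exists z.
Qed.

(** * Bounded type as a local condition *)

Lemma occurs_in_infix (L : choiceType) (u w : seq L) (x : seqspace L) :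
  infix u w -> occurs_in w x -> occurs_in u x.
Proof.
move=> /infixP[p [q ->]] [i e]; exists (i + size p)%N.
apply: (@eq_from_nth _ (x 0%N)) => [|j ju]; first by rewrite size_mkseq.
have := congr1 (fun s => nth (x 0%N) s (size p + j)) e.
rewrite nth_cat ltnNge leq_addr/= addKn nth_cat ju => ->.
by rewrite !nth_mkseq ?addnA// !size_cat ltn_add2l (leq_trans ju)// leq_addr.
Qed.

Lemma subshift_iter (L : choiceType) (G : set (seqspace L)) (x : seqspace L) i :
  subshift G -> G x -> G (iter i (@shift_map L) x).
Proof.
move=> [_ GE] Gx; elim: i => [//|i IH].
by rewrite iterS -GE; exists (iter i (@shift_map L) x).
Qed.

(** A prefix of [x] occurs in some point of [G] at some position [i]; the [i]-th shift of that point
    stays in [G] and starts with this prefix. Hence [x] is adherent to the closed set [G]. *)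
Lemma subshift_allowed (R : realType) (L : choiceType) (G : set (seqspace L))
    (x : seqspace L) :
  subshift G -> (forall n, allowed G (mkseq x n.+1)) -> G x.
Proof.
move=> sG xG; apply: sG.1; apply/(closure_agree R) => n.
have [_ [y Gy [i]]] := xG n; rewrite size_mkseq => e.
exists (iter i (@shift_map L) y); first exact: subshift_iter.
move=> j jn; rewrite iter_shift_map.
have := congr1 (fun s => nth (x 0%N) s j) e.
by rewrite !nth_mkseq.
Qed.

(** Otherwise some prefix of [x] is forbidden and contains a basis word of length less than [n]. The
    point of [G] that copies [x] where this word occurs makes the word allowed, a contradiction. *)
Lemma bounded_type_local (R : realType) (L : choiceType)
    (G : set (seqspace L)) :
  subshift G -> bounded_type G ->
  exists n, forall x : seqspace L,
    (forall i, exists2 y, G y & agree n (iter i (@shift_map L) x) y) -> G x.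
Proof.
move=> sG [F [Fforb Fbasis] [n Fn]]; exists n => x xG.
apply: (subshift_allowed R) => // m; apply: contrapT => nall.
have [|u Fu uw] := Fbasis (mkseq x m.+1); first by split.
have [u0 []] := Fforb u Fu; split=> //.
have [|i ui] := occurs_in_infix _ _ _ x uw.
  by exists 0%N; rewrite size_mkseq.
have [y Gy xy] := xG i; exists y => //; exists 0%N.
rewrite {1}ui; apply/eq_in_map => j; rewrite mem_iota add0n => /andP[_ ju].
by rewrite -xy ?iter_shift_map// ltnW// (leq_trans ju)// ltnW// Fn.
Qed.

(** * Separability over a countable alphabet *)

(** Pigeonhole: otherwise the [N.+1] numbers from [N] to [N + N] would be sent injectively below
    [N]. *)
Lemma injective_unbounded (f : nat -> nat) :
  injective f -> forall N, exists2 m, (N <= m)%N & (N <= f m)%N.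
Proof.
move=> fi N; apply: contrapT => nex.
have fN m : (N <= m)%N -> (f m < N)%N.
  by move=> Nm; rewrite ltnNge; apply/negP => Nfm; apply: nex; exists m.
pose g (i : 'I_N.+1) : 'I_N := Ordinal (fN _ (leq_addr i N)).
have /leq_card : injective g.
  by move=> i j /(congr1 val)/= /fi /addnI /val_inj.
by rewrite !card_ord ltnn.
Qed.

(** Take for [t k] a point of [Z] that begins with the word of code [k], or the default [z0] if
    there is none. The prefixes of [z] have pairwise distinct codes, so long prefixes with large
    codes exist; this gives approximations of [z] at arbitrarily large indices. *)
Lemma dense_sequence (L : countType) (Z : set (seqspace L)) :
  Z !=set0 ->
  exists t : nat -> seqspace L, (forall k, Z (t k)) /\
    forall z, Z z -> forall n N, exists2 k, (N <= k)%N & agree n z (t k).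
Proof.
move=> [z0 Zz0].
pose P k z := Z z /\ (forall w : seq L, unpickle k = Some w ->
   (exists2 y : seqspace L, Z y & w = mkseq y (size w)) ->
   w = mkseq z (size w)).
have /choice[t tP] : forall k, exists z, P k z.
  move=> k; case E : (unpickle k : option (seq L)) => [w|]; last first.
    by exists z0; split=> // w; rewrite E.
  have [[y Zy wy]|nw] :=
      pselect (exists2 y : seqspace L, Z y & w = mkseq y (size w)).
    by exists y; split=> // v; rewrite E => -[<-].
  by exists z0; split=> // v; rewrite E => -[<-] /nw.
exists t; split=> [k|z Zz n N]; first by have [] := tP k.
pose f m := pickle (mkseq z m : seq L).
have fi : injective f.
  move=> a b /(pcan_inj pickleK) /(congr1 size).
  by rewrite !size_mkseq.
(* The bound [n.+1] on the length [m] covers the indices up to [n]; the bound [N] on the code [f m]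
   makes the index late. *)
have [m mN fN] := injective_unbounded f fi (maxn N n.+1).
exists (f m); first by apply: leq_trans fN; rewrite leq_maxl.
have [_ /(_ (mkseq z m))] := tP (f m).
rewrite size_mkseq => /(_ (pickleK _)) e i ni.
have im : (i < m)%N.
  by rewrite (leq_trans _ mN)// (leq_trans _ (leq_maxr _ _)).
have /(congr1 (fun s => nth (z 0%N) s i)) : mkseq z m = mkseq (t (f m)) m.
  by apply: e; exists z => //; rewrite size_mkseq.
by rewrite !nth_mkseq.
Qed.

(** * Concatenated chains and shadowing *)

(* [s = (k, i)] is position [i] of the [k]-th chain, of length [l k]. *)
Definition chain_step (l : nat -> nat) (s : nat * nat) : nat * nat :=
  if (s.2.+1 < l s.1)%N then (s.1, s.2.+1) else (s.1.+1, 0%N).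

Definition chain_state (l : nat -> nat) (m : nat) : nat * nat :=
  iter m (chain_step l) (0, 0)%N.

Lemma chain_state_lt (l : nat -> nat) m :
  (forall k, 0 < l k)%N -> ((chain_state l m).2 < l (chain_state l m).1)%N.
Proof.
move=> l0; elim: m => [|m IH]; first exact: l0.
by rewrite /chain_state iterS -/(chain_state l m) /chain_step; case: ifP.
Qed.

Lemma chain_state_mono (l : nat -> nat) m n :
  (m <= n)%N -> ((chain_state l m).1 <= (chain_state l n).1)%N.
Proof.
move=> /subnK <-; elim: (n - m)%N => [//|d IH]; apply: leq_trans IH _.
rewrite addSn /chain_state iterS -/(chain_state _ _) /chain_step.
by case: ifP => //= _; apply: leqnSn.
Qed.

(** Each chain takes finitely many steps, and at least one; the latter gives [k <= p], so starts of
    late chains are reached at late times. *)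
Lemma chain_state_reach (l : nat -> nat) k :
  (forall k, 0 < l k)%N ->
  exists2 p, (k <= p)%N & chain_state l p = (k, 0)%N.
Proof.
move=> l0; elim: k => [|k [p kp pk]]; first by exists 0%N.
have mid i : (i < l k)%N -> chain_state l (i + p) = (k, i).
  elim: i => [//|i IH] il; rewrite addSn /chain_state iterS.
  by rewrite -/(chain_state _ _) IH 1?ltnW// /chain_step /= il.
exists (l k + p)%N; first by rewrite -add1n leq_add.
rewrite -(prednK (l0 k)) addSn /chain_state iterS -/(chain_state _ _).
by rewrite mid ?prednK// /chain_step /= prednK// ltnn.
Qed.

(* The errors start below [2 ^- n0], which makes the shadowing point satisfy
   the local constraints of the subshift from its first symbol on. *)
Lemma dense_pseudo_orbit (R : realType) (L : countType)
    (Z : set (seqspace L)) (n0 : nat) :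
  Z !=set0 -> internally_chain_transitive R Z ->
  exists (z : nat -> seqspace L) (D : nat -> nat),
    [/\ forall m, Z (z m),
        forall m, agree (D m) (shift_map (z m)) (z m.+1),
        [/\ forall m, (n0 <= D m)%N, forall m n, (m <= n)%N -> (D m <= D n)%N &
            forall k, exists m, (k <= D m)%N] &
        forall y, Z y -> forall n N, exists2 m, (N <= m)%N & agree n y (z m)].
Proof.
move=> /dense_sequence[t [Zt tdense]] Zict.
have /choice[l /choice[c lc]] : forall k, exists l c,
    [/\ (0 < l)%N, c 0%N = t k, c l = t k.+1,
        forall i, (i <= l)%N -> Z (c i) &
        forall i, (i < l)%N -> agree (n0 + k) (shift_map (c i)) (c i.+1)].
  move=> k; have [|l [c [l0 c0 cl cZ cd]]] :=
    Zict _ _ (Zt k) (Zt k.+1) (2^-1 ^+ (n0 + k)).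
    by rewrite exprn_gt0// invr_gt0 ltr0n.
  by exists l, c; split=> // i /cd /sdist_lt.
have l0 k : (0 < l k)%N by have [] := lc k.
pose s := chain_state l.
exists (fun m => c (s m).1 (s m).2), (fun m => n0 + (s m).1)%N; split.
- move=> m; have [_ _ _ + _] := lc (s m).1; apply.
  exact/ltnW/chain_state_lt.
- move=> m; have [_ _ cl _ /(_ _ (chain_state_lt l m l0))] := lc (s m).1.
  rewrite [s m.+1]/(chain_step l (s m)) /chain_step -/s.
  have sm : ((s m).2 < l (s m).1)%N by apply: chain_state_lt.
  (* At the end of a chain, its last point [t k.+1] is also the first point of the next chain, so
     the junction adds no error. *)
  case: ltnP => //= le.
  have -> : (s m).2.+1 = l (s m).1 by apply/eqP; rewrite eqn_leq sm le.
  by have [_ -> _ _ _] := lc (s m).1.+1; rewrite cl.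
- split=> [m|m n mn|k]; first exact: leq_addr.
    by rewrite leq_add2l chain_state_mono.
  have [p _ pk] := chain_state_reach l k l0.
  by exists p; rewrite /s pk leq_addl.
- move=> y Zy n N; have [k Nk yt] := tdense y Zy n N.
  have [p kp pk] := chain_state_reach l k l0.
  exists p; first exact: leq_trans kp.
  by rewrite /s pk /=; have [_ -> _ _ _] := lc k.
Qed.

(** Symbol [i] of [z m] is symbol [i - 1] of [z m.+1], and so on down to symbol [0] of [z (m + i)].
    As [D] is nondecreasing, each of these moves stays within the guaranteed agreement. *)
Lemma pseudo_orbit_shadow (L : choiceType) (z : nat -> seqspace L)
    (D : nat -> nat) :
  (forall m, agree (D m) (shift_map (z m)) (z m.+1)) ->
  (forall m n, (m <= n)%N -> (D m <= D n)%N) ->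
  forall m, agree (D m) (iter m (@shift_map L) (fun k => z k 0%N)) (z m).
Proof.
move=> zD Dmono m i; rewrite iter_shift_map.
elim: i m => [|i IH] m im; first by rewrite addn0.
rewrite -addSnnS IH; last by rewrite (leq_trans _ (Dmono _ _ (leqnSn m)))// ltnW.
by rewrite -zD// ltnW.
Qed.

Theorem theorem16 (R : realType) (Lambda : countType)
    (Gamma : set (seqspace Lambda)) (Z : set (seqspace Lambda))
    (hGamma : subshift Gamma) (hSBT : bounded_type Gamma)
    (hZ0 : Z !=set0) (hZGamma : Z `<=` Gamma) (hZclosed : closed Z)
    (hZICT : internally_chain_transitive R Z) :
  exists x : seqspace Lambda,
    [/\ Gamma x,
        Z = omega_limit x &
        forall eps : R, 0 < eps ->
          exists N : nat, forall i : nat, (N <= i)%N ->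
            sdist_set R (iter i (@shift_map Lambda) x) Z < eps].
Proof.
have [n0 Gloc] := bounded_type_local R _ _ hGamma hSBT.
have [z [D [Zz zD [Dn0 Dmono Dinfty] zdense]]] :=
  dense_pseudo_orbit R _ _ n0 hZ0 hZICT.
pose x : seqspace Lambda := fun k => z k 0%N.
have xz m : agree (D m) (iter m (@shift_map Lambda) x) (z m).
  exact: pseudo_orbit_shadow.
have xzn n : exists N, forall m, (N <= m)%N ->
    agree n (iter m (@shift_map Lambda) x) (z m).
  have [N nN] := Dinfty n; exists N => m Nm.
  by apply: agree_le (xz m); apply: leq_trans nN (Dmono _ _ Nm).
exists x; split.
- apply: Gloc => i; exists (z i); first exact: hZGamma.
  exact: agree_le (xz i).
- apply/seteqP; split=> [y Zy|y /(omega_limit_agree R) xy].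
    apply/(omega_limit_agree R) => n N; have [M xM] := xzn n.
    have [m] := zdense y Zy n (maxn N M).
    rewrite geq_max => /andP[Nm Mm] yz.
    by exists m => //; apply: agree_trans yz _; apply/agree_sym/xM.
  (* Late shifts of [x] are close to the points [z i] of [Z], so a limit of such shifts is adherent
     to [Z]. *)
  apply: hZclosed; apply/(closure_agree R) => n; have [M xM] := xzn n.
  have [i Mi yi] := xy n M.
  by exists (z i) => //; apply: agree_trans yi _; apply: xM.
- move=> eps /half_expr_lt[n neps]; have [N xN] := xzn n.
  by exists N => i Ni; apply: lt_trans neps; apply: sdist_set_lt (Zz i) (xN i Ni).
Qed.
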